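(* Let $n, q \ge 1$ and $s \geq 2$ be integers. The total number $C_T(n, q, s)$ of $s$-collisions in all arrangements of $q$ numbered balls in $n$ numbered tubes is equal to $$ q!\sum_{\lambda} \binom{n}{\lambda_1} \left( \prod_{i=2}^{k} \binom{\lambda_{i-1}}{\lambda_i} \right) \left( \lambda_{k}\binom{k}{s} + \sum_{i=s}^{k-1} ( \lambda_{i} - \lambda_{i+1} )\binom{i}{s} \right), $$ where the sum is over all partitions $\lambda = (\lambda_1,\dots,\lambda_k)$ of $q$ such that $\lambda_1 \leq n$ and whose number of parts $k = |\lambda|$ satisfies $k \geq s$.
   Context: A partition $\lambda$ of a positive integer $q$ is a sequence of integers $\lambda_1 \ge \lambda_2 \ge \dots \ge \lambda_k \ge 1$ with $\sum_{i=1}^k \lambda_i = q$; $k = |\lambda|$ is the number of parts (it depends on $\lambda$). An arrangement of $q$ numbered (distinguishable) balls in $n$ numbered tubes places every ball in exactly one tube, and the order of the balls within each tube (as a column) matters. That is, an arrangement is an assignment to each tube $j \in \{1,\dots,n\}$ of a finite (possibly empty) ordered list of balls such that each of the $q$ balls occurs exactly once in total. Let $s \ge 2$. A tube containing $r$ balls contributes $\binom{r}{s}$ to the number of $s$-collisions of an arrangement (so it contributes $0$ if $r < s$). The number of $s$-collisions of an arrangement is the sum of these contributions over all $n$ tubes, and $C_T(n,q,s)$ is the sum of the numbers of $s$-collisions over all arrangements of $q$ balls in $n$ tubes. Empty products equal $1$ and empty sums equal $0$. *)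

(* Defs.v *)
From mathcomp Require Import all_boot.
Set Implicit Arguments.
Unset Strict Implicit.
Unset Printing Implicit Defensive.

Definition is_arrangement (n q : nat) (A : 'I_n -> seq 'I_q) : bool :=
  [forall b : 'I_q, \sum_(j < n) count_mem b (A j) == 1].

(* No tube of an arrangement holds more than q balls, so bounding the columns
   by q loses nothing and makes the type of candidates finite. *)
Lemma is_arrangement_size (n q : nat) (A : 'I_n -> seq 'I_q) (j : 'I_n) :
  is_arrangement A -> size (A j) <= q.
Proof.
move=> /forallP hA.
have uA : uniq (A j).
  apply: count_mem_uniq => b.
  have := hA b; rewrite (bigD1 j) //= -has_pred1 has_count.
  by case: (count_mem b (A j)) => [|[|m]].
by rewrite -(card_uniqP uA) (leq_trans (max_card _)) // card_ord.
Qed.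

Definition collisions (n q s : nat) (A : 'I_n -> seq 'I_q) : nat :=
  \sum_(j < n) 'C(size (A j), s).

Definition total_collisions (n q s : nat) : nat :=
  \sum_(A : {ffun 'I_n -> q.-bseq 'I_q} | is_arrangement (fun j => A j))
    collisions s (fun j => A j).

Definition is_partition (q : nat) (l : seq nat) : bool :=
  [&& sorted geq l, all (leq 1) l & sumn l == q].

(* A partition of q has at most q parts, each at most q. *)
Definition partitions (q : nat) : seq (seq nat) :=
  [seq map val (val l) | l : q.-bseq 'I_q.+1 in
     [pred l : q.-bseq 'I_q.+1 | is_partition q (map val (val l))]].

Lemma partitions_uniq (q : nat) : uniq (partitions q).
Proof.
rewrite map_inj_uniq ?enum_uniq // => l1 l2 /(inj_map val_inj) e.
exact: val_inj.
Qed.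

Lemma mem_partitions (q : nat) (l : seq nat) :
  (l \in partitions q) = is_partition q l.
Proof.
apply/imageP/idP => [[x hx ->] // | hl].
have /and3P [_ pos /eqP sq] := hl.
have szl : size l <= q.
  rewrite -sq; elim: l pos {hl sq} => //= x l IH /andP [x0 /IH h].
  by rewrite -add1n leq_add.
have bl : all (fun x => x < q.+1) l.
  apply/allP => x xl; rewrite ltnS -sq.
  elim: l xl {hl pos sq szl} => //= y l IH.
  rewrite inE => /orP [/eqP ->|/IH h]; first exact: leq_addr.
  exact: leq_trans h (leq_addl _ _).
have sz' : size (map (@inord q) l) <= q by rewrite size_map.
have e : map val (map (@inord q) l) = l.
  rewrite -map_comp map_id_in // => x xl /=.
  by rewrite inordK //; apply: (allP bl).
by exists (Bseq sz'); rewrite ?inE /= e.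
Qed.

(* 1-based, and 0 for i > size l. As partitions are nonincreasing, the truncated
   difference part l i - part l i.+1 is the genuine one. *)
Definition part (l : seq nat) (i : nat) : nat := nth 0 l i.-1.

(* Main.v *)
(* An arrangement is a vector f of tube sizes with sum q together with an ordering
   of the q balls, read off tube after tube, so each f accounts for q! arrangements.
   Group the vectors f by the conjugate partition l_i = #{j | i <= f j}. Such an f
   amounts to a chain of subsets of the tubes of sizes l_1 >= l_2 >= ..., which the
   product of binomials counts, and exactly l_i - l_(i+1) tubes hold i balls. *)
Require Import Defs.
From mathcomp Require Import all_boot.

Set Implicit Arguments.
Unset Strict Implicit.
Unset Printing Implicit Defensive.

(** * Level sets and the conjugate partition *)

Section Conjugate.
Variable T : finType.
Implicit Types (f : T -> nat).

(* [level f d] is the part of index [d.+1] of the conjugate partition. *)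
Definition level f d : nat := #|[set j | d < f j]|.

(** The offset [d] drops the first [d] parts, so that an induction can peel off one level at a
    time. *)
Definition conjugate f d : seq nat :=
  [seq level f i | i <- iota d (\max_j f j - d)].

Lemma level_gt0 f d : (0 < level f d) = (d < \max_j f j).
Proof.
rewrite card_gt0 [RHS]ltnNge; congr (~~ _).
apply/eqP/bigmax_leqP => [e j _ | h]; last first.
  by apply/setP => j; rewrite !inE ltnNge h.
by rewrite leqNgt; have /setP/(_ j) := e; rewrite !inE => ->.
Qed.

Lemma level_ge_max f d : \max_j f j <= d -> level f d = 0.
Proof. by rewrite leqNgt -level_gt0; case: level. Qed.

Lemma level_le f d e : d <= e -> level f e <= level f d.
Proof.
move=> le_de; apply/subset_leq_card/subsetP => j; rewrite !inE.
exact: leq_ltn_trans.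
Qed.

Lemma conjugate_eq_cons f d x l : 0 < x ->
  (conjugate f d == x :: l) = (level f d == x) && (conjugate f d.+1 == l).
Proof.
move=> x_gt0; rewrite /conjugate; case: (ltnP d (\max_j f j)) => h.
  by rewrite -(subnSK h) /= eqseq_cons.
(* The conjugate is empty and the level is 0, so both sides fail since [x] is positive. *)
rewrite (level_ge_max h) (eqnP h) /=.
by case: x x_gt0.
Qed.

Lemma conjugate_eq_nil f d : (conjugate f d == [::]) = [forall j, f j <= d].
Proof.
rewrite -size_eq0 size_map size_iota subn_eq0.
by apply/bigmax_leqP/forallP => h j; auto.
Qed.

(** Double counting of the pairs [(i, j)] with [i < f j]. *)
Lemma sum_level f m : \max_j f j <= m -> \sum_(i < m) level f i = \sum_j f j.
Proof.
move=> le_m; under [LHS]eq_bigr => i _ do rewrite /level -sum1_card big_mkcond.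
rewrite exchange_big /=; apply: eq_bigr => j _.
under eq_bigr do rewrite inE.
rewrite -big_mkcond /=.
have le_fm : f j <= m := leq_trans (leq_bigmax j) le_m.
by rewrite -(big_ord_widen m (fun=> 1) le_fm) sum1_card card_ord.
Qed.

Lemma nth_conjugate f i : nth 0 (conjugate f 0) i = level f i.
Proof.
case: (ltnP i (\max_j f j)) => h.
  by rewrite (nth_map 0) ?size_iota ?subn0 // nth_iota ?subn0.
by rewrite nth_default ?level_ge_max // size_map size_iota subn0.
Qed.

Lemma conjugate_partition q f :
  is_partition q (conjugate f 0) = (\sum_j f j == q).
Proof.
rewrite /is_partition -(sum_level (leqnn _)) sumnE big_map.
rewrite -[iota _ _]/(index_iota 0 _) big_mkord.
suff [-> ->] : sorted geq (conjugate f 0) /\ all (leq 1) (conjugate f 0) by [].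
split.
  rewrite sorted_map; apply: sub_sorted (iota_sorted 0 _) => i j.
  exact: level_le.
rewrite all_map; apply/allP => i; rewrite mem_iota subn0 /=.
by rewrite level_gt0.
Qed.

Lemma card_fiber_level f i :
  #|[set j | f j == i.+1]| = level f i - level f i.+1.
Proof.
rewrite /level -cardsDS; last by apply/subsetP => j; rewrite !inE; apply: ltnW.
apply: eq_card => j; rewrite !inE.
by rewrite -leqNgt eqn_leq.
Qed.

(** Group the [j] by the value [i] of [f j]: the fiber over [i] is a difference of two nested level
    sets. Values below [s] have weight 0, and [1 <= s] keeps [i.-1] a true predecessor. *)
Lemma sum_level_diff f s (w : nat -> nat) : 1 <= s ->
    (forall i, i < s -> w i = 0) ->
  \sum_j w (f j) =
  \sum_(s <= i < (\max_j f j).+1) (level f i.-1 - level f i) * w i.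
Proof.
move=> s_gt0 w0.
have split_w j : w (f j) =
    \sum_(s <= i < (\max_j f j).+1) (f j == i) * w i.
  case: (ltnP (f j) s) => [lt_s | le_s].
    rewrite (w0 _ lt_s) big_nat_cond big1 // => i /andP[/andP[le_si _] _].
    by rewrite (ltn_eqF (leq_trans lt_s le_si)).
  rewrite (bigD1_seq (f j)) ?iota_uniq //=; last first.
    by rewrite mem_index_iota le_s ltnS leq_bigmax.
  by rewrite eqxx mul1n big1 ?addn0 // => i; rewrite eq_sym => /negPf ->.
under [LHS]eq_bigr => j _ do rewrite split_w.
rewrite exchange_big /=; apply: eq_big_nat => -[|i] /andP[le_si _].
  by have := leq_trans s_gt0 le_si.
rewrite -big_distrl -card_fiber_level -sum1_card [in RHS]big_mkcond /=.
by congr (_ * _); apply: eq_bigr => j _; rewrite inE; case: eqP.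
Qed.

End Conjugate.

(** * Chains of subsets, and functions with a given conjugate *)

Fixpoint chain_weight m l : nat :=
  if l is x :: l' then 'C(m, x) * chain_weight x l' else 1.

Lemma chain_weightE m x l :
  chain_weight m (x :: l) =
  'C(m, part (x :: l) 1) *
  \prod_(2 <= i < (size (x :: l)).+1) 'C(part (x :: l) i.-1, part (x :: l) i).
Proof.
rewrite /= {2}/part /=; congr (_ * _).
elim: l x => [|y l IH] x; first by rewrite big_geq.
rewrite big_nat_recl //= IH; congr (_ * _).
by rewrite !big_add1 /=; apply: eq_big_nat => -[|i].
Qed.

(* The functions are pinned down off [A]; peeling the first part off [l] chooses
   the subset of [A] of that size on which [f] exceeds [d]. *)
Lemma card_conjugate_on (T : finType) q (l : seq nat) d (A : {set T})
    (f0 : {ffun T -> 'I_q.+1}) :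
    all (leq 1) l -> d + size l <= q -> (forall j, j \notin A -> f0 j <= d) ->
  #|[set f : {ffun T -> 'I_q.+1} |
      [&& [forall (j | j \notin A), f j == f0 j], [forall (j | j \in A), d <= f j]
        & conjugate (fun j => f j) d == l]]| = chain_weight #|A| l.
Proof.
elim: l d A f0 => [|x l IH] d A f0 /=.
  rewrite addn0 => _ le_dq f0_le.
  (* With no part left, [f] is squeezed to [d] on [A] and pinned elsewhere, so [g] is the only
     candidate. *)
  pose g : {ffun T -> 'I_q.+1} := [ffun j => if j \in A then inord d else f0 j].
  rewrite (_ : [set _ | _] = [set g]) ?cards1 //; apply/setP => f.
  rewrite !inE conjugate_eq_nil; apply/and3P/eqP => [[/forall_inP h1 /forall_inP h2 /forallP h3] | ->].
    apply/ffunP => j; rewrite ffunE; case: ifPn => [jA | /h1/eqP //].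
    by apply/val_inj/eqP; rewrite /= inordK // eqn_leq h3 h2.
  split; first by apply/forall_inP => j /negPf jA; rewrite ffunE jA.
    by apply/forall_inP => j jA; rewrite ffunE jA inordK.
  apply/forallP => j; rewrite ffunE; case: ifPn => [jA|/f0_le //].
  by rewrite inordK.
move=> /andP[x_gt0 pos_l] le_q f0_le.
pose g : {ffun T -> 'I_q.+1} := [ffun j => if j \in A then inord d else f0 j].
(* This makes [inord d] have value [d]. *)
have lt_dq : d < q.+1.
  by rewrite ltnS (leq_trans _ le_q) // leq_addr.
(* Sort the functions by the set [B] where they exceed [d]; the choices of [B] give the factor
   ['C(#|A|, x)]. *)
rewrite -[LHS]sum1_card (partition_big (fun f : {ffun T -> 'I_q.+1} => [set j | d < f j])
   (fun B : {set T} => (B \subset A) && (#|B| == x))) /=; last first.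
  move=> f; rewrite inE conjugate_eq_cons // => /and3P[/forall_inP h1 _ /andP[-> _]].
  rewrite andbT; apply/subsetP => j; rewrite inE; apply: contraLR => jA.
  by rewrite (eqP (h1 j jA)) -leqNgt f0_le.
rewrite (eq_bigr (fun=> chain_weight x l)) => [|B /andP[sBA /eqP cB]].
  rewrite sum_nat_const; congr (_ * _).
  by rewrite -(cards_draws A x) cardsE.
(* Once [B] is chosen, [f] equals [d] on the rest of [A], so [g] is the function to which [f] is
   pinned off [B]. *)
rewrite -cB -(IH d.+1 B g) ?addSnnS //; last first.
  move=> j jB; rewrite ffunE; case: ifPn => [jA | /f0_le/leqW //].
  by rewrite inordK.
rewrite sum1_card; apply: eq_card => f.
rewrite [RHS]inE unfold_in /= inE conjugate_eq_cons ?cB //.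
apply/andP/and3P => [[/and3P[/forall_inP h1 /forall_inP h2 /andP[_ h3]] /eqP eB]|].
  split=> //; last by apply/forall_inP => j; rewrite -eB inE.
  apply/forall_inP => j jB; rewrite ffunE; case: ifPn => [jA | /h1 //].
  apply/eqP/val_inj/eqP; rewrite /= inordK // eqn_leq h2 // andbT.
  by move: jB; rewrite -eB inE -leqNgt.
case=> /forall_inP h1 /forall_inP h2 h3.
have eB : [set j | d < f j] = B.
  apply/setP => j; rewrite inE; apply/idP/idP => [|/h2 //].
  apply: contraLR => jB; rewrite (eqP (h1 j jB)) ffunE -leqNgt.
  by case: ifPn => [_|/f0_le //]; rewrite inordK.
rewrite /level eB cB eqxx h3; split=> //; apply/and3P; split=> //.
  apply/forall_inP => j jA; have jB : j \notin B by apply: contra jA; apply/subsetP.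
  by rewrite (eqP (h1 j jB)) ffunE (negPf jA).
apply/forall_inP => j jA; case: (boolP (j \in B)) => [/h2/ltnW // | jB].
by rewrite (eqP (h1 j jB)) ffunE jA inordK.
Qed.

Lemma card_conjugate (T : finType) q (l : seq nat) :
    all (leq 1) l -> size l <= q ->
  #|[set f : {ffun T -> 'I_q.+1} | conjugate (fun j => f j) 0 == l]| = chain_weight #|T| l.
Proof.
move=> pos_l sz_l.
rewrite -[#|T|]cardsT -(@card_conjugate_on _ q l 0 setT [ffun=> ord0]) //; last first.
  by move=> j; rewrite inE.
apply: eq_card => f; rewrite !inE.
have -> : [forall (j | j \notin [set: T]), f j == [ffun=> ord0] j].
  by apply/forall_inP => j; rewrite inE.
by have -> : [forall (j | j \in [set: T]), 0 <= f j] by apply/forall_inP.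
Qed.

(** * Arrangements with prescribed tube sizes *)

Lemma is_arrangement_flatten n q (A : 'I_n -> seq 'I_q) :
  is_arrangement A = perm_eq (flatten (codom A)) (enum 'I_q).
Proof.
have cnt b : count_mem b (flatten (codom A)) = \sum_(j < n) count_mem b (A j).
  by rewrite count_flatten sumnE !big_map -big_enum.
apply/forallP/idP => [h | /permP h b].
  apply/allP => b _; apply/eqP; rewrite cnt (eqP (h b)).
  by rewrite count_uniq_mem ?enum_uniq // mem_enum.
by rewrite -cnt h count_uniq_mem ?enum_uniq // mem_enum.
Qed.

Lemma nth_codom_ord (S : Type) n (g : 'I_n -> S) x0 (j : 'I_n) :
  nth x0 (codom g) j = g j.
Proof. by rewrite (nth_map j) ?size_enum_ord // nth_ord_enum. Qed.

(** Cutting a word of length [q] into columns of the given sizes is inverse to concatenating the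
    columns, so these arrangements correspond to the duplicate-free [q]-tuples of balls. *)
Lemma card_arrangements_shape n q (f : {ffun 'I_n -> 'I_q.+1}) :
    \sum_j f j = q ->
  #|[set A : {ffun 'I_n -> q.-bseq 'I_q} |
      is_arrangement (fun j => A j) && [forall j, size (A j) == f j]]| = q`!.
Proof.
move=> sum_f; pose sh := codom (fun j => f j : nat).
have sum_sh : sumn sh = q by rewrite -[RHS]sum_f sumnE big_map big_enum.
pose cut (t : q.-tuple 'I_q) : {ffun 'I_n -> q.-bseq 'I_q} :=
  [ffun j : 'I_n => insub_bseq q (nth [::] (reshape sh t) j)].
have shape_cut (t : q.-tuple 'I_q) : shape (reshape sh t) = sh.
  by apply: reshapeKl; rewrite sum_sh size_tuple.
have size_cut (t : q.-tuple 'I_q) (j : 'I_n) : size (nth [::] (reshape sh t) j) = f j.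
  by rewrite -nth_shape shape_cut nth_codom_ord.
(* Since [f j <= q], [insub_bseq] never falls back to its default. *)
have val_cut t j : cut t j = nth [::] (reshape sh t) j :> seq _.
  by rewrite ffunE val_insubd size_cut -ltnS ltn_ord.
have codom_cut t : codom (fun j => cut t j : seq _) = reshape sh t.
  have sz : size (reshape sh t) = n.
    by rewrite -(size_map size) -/(shape _) shape_cut size_map size_enum_ord.
  rewrite /codom /image_mem (eq_map (val_cut t)).
  by rewrite (map_comp _ val) val_enum_ord -{1}sz -/(mkseq _ _) mkseq_nth.
have flatten_cut t : flatten (codom (fun j => cut t j : seq _)) = t.
  by rewrite codom_cut reshapeKr // sum_sh size_tuple.
have cut_inj : injective cut.
  by move=> t u e; apply: val_inj; rewrite /= -(flatten_cut t) e flatten_cut.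
have := card_uniq_tuples q (@predT 'I_q); rewrite card_ord ffactnn => <-.
rewrite -(card_imset _ cut_inj); apply: eq_card => A; rewrite inE.
rewrite is_arrangement_flatten; apply/andP/imsetP => [[perm_A /forallP size_A] | [t]].
  have szA : size (flatten (codom (fun j => A j : seq _))) == q.
    by rewrite (perm_size perm_A) size_enum_ord.
  exists (Tuple szA).
    by rewrite inE /= all_predT (perm_uniq perm_A) enum_uniq.
  apply/ffunP => j; apply/val_inj; rewrite /= val_cut /=.
  rewrite (_ : sh = shape (codom (fun j => A j : seq _))).
    by rewrite flattenK nth_codom_ord.
  by rewrite /shape -map_comp; apply/eq_map => i /=; rewrite (eqP (size_A i)).
rewrite inE => /andP[_ uniq_t] ->; split; last first.
  by apply/forallP => j; rewrite val_cut size_cut.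
rewrite flatten_cut; apply: uniq_perm; rewrite ?enum_uniq //.
(* A duplicate-free list of [q] balls contains all of them. *)
have sub_t : {subset t <= enum 'I_q} by move=> i _; rewrite mem_enum.
have le_t : size (enum 'I_q) <= size t by rewrite size_tuple size_enum_ord.
by have [] := uniq_min_size uniq_t sub_t le_t.
Qed.

(** The collision count depends only on the tube sizes, so it is constant on each class of
    arrangements with the same sizes. *)
Lemma total_collisions_shape n q s :
  total_collisions n q s =
  q`! * \sum_(f : {ffun 'I_n -> 'I_q.+1} | \sum_j f j == q) \sum_j 'C(f j, s).
Proof.
pose shape_of (A : {ffun 'I_n -> q.-bseq 'I_q}) : {ffun 'I_n -> 'I_q.+1} :=
  [ffun j => inord (size (A j))].
have shape_ofE A j : shape_of A j = size (A j) :> nat.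
  by rewrite ffunE inordK // ltnS size_bseq.
rewrite /total_collisions (partition_big shape_of (fun f => \sum_j f j == q)) /=; last first.
  move=> A; rewrite is_arrangement_flatten => /perm_size.
  rewrite size_enum_ord size_flatten sumnE big_map big_map big_enum /= => sum_A.
  by under eq_bigr do rewrite shape_ofE; rewrite sum_A.
rewrite big_distrr; apply: eq_bigr => f /eqP sum_f.
rewrite (eq_bigr (fun=> \sum_j 'C(f j, s))) => [|A /andP[_ /eqP <-]]; last first.
  by apply: eq_bigr => j _; rewrite shape_ofE.
rewrite sum_nat_const -(card_arrangements_shape sum_f); congr (_ * _).
rewrite [RHS]cardsE; apply: eq_card => A; rewrite !unfold_in; congr (_ && _).
apply/eqP/forallP => [<- j | h]; first by rewrite shape_ofE.
by apply/ffunP => j; apply/val_inj; rewrite /= shape_ofE (eqP (h j)).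
Qed.

(** * Collisions in terms of the conjugate partition *)

Lemma sum_bin_conjugate (T : finType) (f : T -> nat) s l : 0 < s ->
    conjugate f 0 = l -> 
  \sum_j 'C(f j, s) =
  if s <= size l then
    part l (size l) * 'C(size l, s)
       + \sum_(s <= i < size l) (part l i - part l i.+1) * 'C(i, s)
  else 0.
Proof.
move=> s_gt0 <-; have partE i : part (conjugate f 0) i = level f i.-1.
  exact: nth_conjugate.
rewrite (@sum_level_diff _ f s (fun i => 'C(i, s))) //; last by move=> i /bin_small.
have -> : size (conjugate f 0) = \max_j f j by rewrite size_map size_iota subn0.
case: ifP => [le_s | /negbT]; last by rewrite -ltnNge => lt_s; rewrite big_geq.
(* At the top index [\max_j f j] the next level is 0; this yields the isolated term with the last
   part. *)
rewrite big_nat_recr //= addnC partE (level_ge_max (leqnn _)) subn0.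
by congr (_ + _); apply: eq_bigr => i _; rewrite !partE.
Qed.

Theorem theorem5p4 (n q s : nat) (hn : 1 <= n) (hq : 1 <= q) (hs : 2 <= s) :
  total_collisions n q s =
  q`! * \sum_(l <- partitions q | (part l 1 <= n) && (s <= size l))
    'C(n, part l 1)
    * (\prod_(2 <= i < (size l).+1) 'C(part l i.-1, part l i))
    * (part l (size l) * 'C(size l, s)
       + \sum_(s <= i < size l) (part l i - part l i.+1) * 'C(i, s)).
Proof.
rewrite total_collisions_shape; congr (_ * _).
(* The inner sum has a single term if the sizes [f] sum to [q], and is empty otherwise. *)
transitivity (\sum_(f : {ffun 'I_n -> 'I_q.+1})
    \sum_(l <- partitions q | l == conjugate (fun j => f j) 0) \sum_j 'C(f j, s)).
  rewrite big_mkcond; apply: eq_bigr => f _.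
  rewrite -conjugate_partition -mem_partitions; case: ifPn => [c_in | c_notin].
    rewrite [RHS]big_mkcond (bigD1_seq _ c_in) ?partitions_uniq //= eqxx.
    by rewrite [X in _ + X]big1 ?addn0 // => l /negPf ->.
  by rewrite big1_seq // => l /andP[/eqP -> c_in]; rewrite c_in in c_notin.
under [LHS]eq_bigr do rewrite big_mkcond.
rewrite exchange_big [RHS]big_mkcond /= big_seq [RHS]big_seq.
apply: eq_bigr => l; rewrite mem_partitions => /and3P[_ pos_l /eqP sum_l].
have sz_l : size l <= q.
  rewrite -sum_l; elim: l pos_l {sum_l} => //= x l IH /andP[x_gt0 /IH].
  by rewrite -add1n; apply: leq_add.
(* For a fixed [l] the summand no longer depends on [f], so it remains to count the [f] with
   conjugate [l]. *)
rewrite -big_mkcond (eq_bigr _ (fun f e => sum_bin_conjugate (ltnW hs) (esym (eqP e)))).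
rewrite sum_nat_const.
have -> : #|[pred f : {ffun 'I_n -> 'I_q.+1} | l == conjugate (fun j => f j) 0]| =
    chain_weight n l.
  rewrite -[n in RHS]card_ord -(card_conjugate _ pos_l sz_l) cardsE.
  by apply: eq_card => f; rewrite !inE eq_sym.
case: (leqP s (size l)) => [le_s | _]; last by rewrite andbF muln0.
case: l {pos_l sum_l sz_l} le_s => [|x l] le_s; first by have := leq_trans (ltnW hs) le_s.
(* A partition whose first part exceeds [n] contributes 0 through its first binomial. *)
rewrite andbT chain_weightE; case: ifP => // /negbT; rewrite -ltnNge => lt_nx.
by rewrite bin_small.
Qed.
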